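(* Let $K$ be an algebraically closed field of characteristic $0$ and let $H$ be a finite-dimensional Hopf algebra over $K$. If $H$ is rigid, then the dual Hopf algebra $H^{\star}$ is rigid.
   Context: Let $H=(V,\mu_0,\Delta_0,\eta_0,\varepsilon_0,S_0)$ be a Hopf algebra over $K$ and $V[[t]]=V\otimes_K K[[t]]$. A deformation $H_t$ of $H$ is a pair of $K[[t]]$-linear maps $(\mu_t,\Delta_t)$, determined by $\mu_t(x\otimes y)=\sum_{m\ge0}\mu_m(x\otimes y)t^m$ and $\Delta_t(x)=\sum_{m\ge0}\Delta_m(x)t^m$ for $x,y\in V$, with $\mu_m\in Hom(V\otimes V,V)$, $\Delta_m\in Hom(V,V\otimes V)$ and $\mu_0,\Delta_0$ the given structure maps of $H$, which together make $V[[t]]$ a bialgebra over $K[[t]]$ ($\mu_t$ associative, $\Delta_t$ coassociative, $(\mu_t\otimes\mu_t)\circ(id\otimes\tau\otimes id)\circ(\Delta_t\otimes\Delta_t)=\Delta_t\circ\mu_t$ with $\tau$ the twist; unit, counit and antipode are preserved by deformation). Two deformations $H_t,H_t'$ of $H$ are equivalent if there is $\phi_t=Id_V+t\phi_1+t^2\phi_2+\cdots$ with $\phi_k\in End(V)$ such that $H'_t=\phi_t\cdot H_t$, i.e. $\mu'_t=\phi_t^{-1}\circ\mu_t\circ(\phi_t\otimes\phi_t)$ and $\Delta'_t=(\phi_t^{-1}\otimes\phi_t^{-1})\circ\Delta_t\circ\phi_t$. A deformation is trivial if it is equivalent to $H$ (the constant deformation). $H$ is rigid if every deformation of $H$ is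 trivial. *)

(* Defs.v *)
From HB Require Import structures.
From mathcomp Require Import all_boot all_order all_algebra.

Set Implicit Arguments.
Unset Strict Implicit.
Unset Printing Implicit Defensive.

Import GRing.Theory VectorInternalTheory.
Local Open Scope ring_scope.

(** * Tensor products of finite-dimensional vector spaces *)

Section Tensor.
Variable K : fieldType.
Implicit Types U V W X A B C D : vectType K.

(* Coordinates with respect to the standard bases; [tens_extE] and
   [tens_hom_ext] below give the universal property of [pure]. *)
Definition tens U V : vectType K := 'M[K]_(dim U, dim V).

Definition pure U V (u : U) (v : V) : tens U V := (v2r u)^T *m v2r v.

Definition bvec V (i : 'I_(dim V)) : V := r2v (delta_mx 0 i).

Definition bilin U V W (b : U -> V -> W) : Prop :=
  (forall v, linear (b^~ v)) /\ (forall u, linear (b u)).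

(* The linear map induced by a bilinear map. *)
Definition tens_ext_fun U V W (b : U -> V -> W) (T : 'M[K]_(dim U, dim V)) : W :=
  \sum_i \sum_j T i j *: b (bvec i) (bvec j).

Definition tens_ext U V W (b : U -> V -> W) : 'Hom(tens U V, W) :=
  linfun (tens_ext_fun b : tens U V -> W).

Lemma tens_ext_fun_linear U V W (b : U -> V -> W) :
  linear (tens_ext_fun b : tens U V -> W).
Proof.
move=> a S T; rewrite /tens_ext_fun scaler_sumr -big_split; apply: eq_bigr => i _.
rewrite scaler_sumr -big_split; apply: eq_bigr => j _ /=.
by rewrite !mxE scalerDl scalerA.
Qed.

Lemma tens_ext_funE U V W (b : U -> V -> W) (T : tens U V) :
  tens_ext b T = tens_ext_fun b T.
Proof.
pose hL := GRing.isLinear.Build K (tens U V) W *:%R (tens_ext_fun b)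
  (@tens_ext_fun_linear U V W b).
pose L : {linear tens U V -> W} := HB.pack (tens_ext_fun b : tens U V -> W) hL.
exact: (lfunE L).
Qed.

Lemma bvec_sum V (v : V) : v = \sum_i v2r v 0 i *: bvec i.
Proof.
apply: v2r_inj; rewrite linear_sum /= [LHS]row_sum_delta.
by apply: eq_bigr => i _; rewrite linearZ /= r2vK.
Qed.

Lemma linear_sumP U V (f : U -> V) : linear f ->
  forall n (c : 'I_n -> K) (x : 'I_n -> U),
  f (\sum_i c i *: x i) = \sum_i c i *: f (x i).
Proof.
move=> lf n c x.
pose hL := GRing.isLinear.Build K U V *:%R f lf.
pose L : {linear U -> V} := HB.pack f hL.
rewrite -[f]/(L : U -> V) linear_sum; by apply: eq_bigr => i _; rewrite linearZ.
Qed.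

Lemma tens_extE U V W (b : U -> V -> W) :
  bilin b -> forall u v, tens_ext b (pure u v) = b u v.
Proof.
case=> bl br u v; rewrite tens_ext_funE /tens_ext_fun.
rewrite [in RHS](bvec_sum u) (linear_sumP (bl v)); apply: eq_bigr => i _.
rewrite [in RHS](bvec_sum v) (linear_sumP (br _)) scaler_sumr.
by apply: eq_bigr => j _; rewrite mxE big_ord1 !mxE scalerA.
Qed.

Lemma pure_bilin U V : bilin (@pure U V).
Proof.
split=> [v a x y | u a x y]; rewrite /pure linearP /=.
  by rewrite linearP mulmxDl -scalemxAl.
by rewrite mulmxDr -scalemxAr.
Qed.

Lemma tens_sum U V (T : tens U V) :
  T = \sum_i \sum_j (T : 'M_(_, _)) i j *: pure (bvec i) (bvec j).
Proof.
rewrite [LHS](matrix_sum_delta (T : 'M_(_, _))); apply: eq_bigr => i _.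
apply: eq_bigr => j _; congr (_ *: _).
by rewrite /pure /bvec !r2vK trmx_delta mul_delta_mx.
Qed.

Lemma tens_hom_ext U V W (f g : 'Hom(tens U V, W)) :
  (forall u v, f (pure u v) = g (pure u v)) -> f = g.
Proof.
move=> fg; apply/lfunP => T; rewrite (tens_sum T) !linear_sum.
apply: eq_bigr => i _; rewrite !linear_sum; apply: eq_bigr => j _.
by rewrite !linearZ /= fg.
Qed.

Definition tens_map U V U' V' (f : 'Hom(U, U')) (g : 'Hom(V, V')) :
    'Hom(tens U V, tens U' V') :=
  tens_ext (fun u v => pure (f u) (g v)).

Definition tens_assoc U V W :
    'Hom(tens (tens U V) W, tens U (tens V W)) :=
  tens_ext (fun T w => tens_ext (fun u v => pure u (pure v w)) T).

(* id (x) tau (x) id, with tau the twist. *)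
Definition tens_mid A B C D :
    'Hom(tens (tens A B) (tens C D), tens (tens A C) (tens B D)) :=
  tens_ext (fun S T =>
    tens_ext (fun a b => tens_ext (fun c d => pure (pure a c) (pure b d)) T) S).

Definition tens_lunit V : 'Hom(tens K^o V, V) :=
  tens_ext (fun (c : K^o) v => (c : K) *: v).
Definition tens_runit V : 'Hom(tens V K^o, V) :=
  tens_ext (fun v (c : K^o) => (c : K) *: v).

Lemma pureDl U V (u u' : U) (v : V) a :
  pure (a *: u + u') v = a *: pure u v + pure u' v.
Proof. by case: (pure_bilin U V) => l _; apply: l. Qed.
Lemma pureDr U V (u : U) (v v' : V) a :
  pure u (a *: v + v') = a *: pure u v + pure u v'.
Proof. by case: (pure_bilin U V) => _ r; apply: r. Qed.

Lemma tens_ext_linear U V W X (b : X -> U -> V -> W) :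
  (forall u v, linear (fun x => b x u v)) -> forall T, linear (fun x => tens_ext (b x) T).
Proof.
move=> lb T a x y; rewrite !tens_ext_funE /tens_ext_fun scaler_sumr -big_split.
apply: eq_bigr => i _; rewrite scaler_sumr -big_split; apply: eq_bigr => j _ /=.
by rewrite lb scalerDr !scalerA mulrC.
Qed.

Lemma tens_mapE U V U' V' (f : 'Hom(U, U')) (g : 'Hom(V, V')) u v :
  tens_map f g (pure u v) = pure (f u) (g v).
Proof. by apply: tens_extE; split=> ? a x y; rewrite linearP (pureDl, pureDr). Qed.

Lemma tens_assocE U V W (u : U) (v : V) (w : W) :
  tens_assoc U V W (pure (pure u v) w) = pure u (pure v w).
Proof.
have H w' : bilin (fun (u : U) (v : V) => pure u (pure v w')).
  by split=> ? a x y; rewrite ?pureDl ?pureDr.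
rewrite /tens_assoc tens_extE ?tens_extE //; split=> [w'|T]; first exact: linearP.
by apply: tens_ext_linear => u' v' a x y; rewrite !pureDr.
Qed.

Lemma tens_midE A B C D (a : A) (b : B) (c : C) (d : D) :
  tens_mid A B C D (pure (pure a b) (pure c d)) = pure (pure a c) (pure b d).
Proof.
have H a' b' : bilin (fun (c : C) (d : D) => pure (pure a' c) (pure b' d)).
  by split=> ? k x y; rewrite ?pureDl ?pureDr ?pureDl.
have H' T : bilin (fun (a : A) (b : B) =>
    tens_ext (fun (c : C) (d : D) => pure (pure a c) (pure b d)) T).
  by split=> u; apply: tens_ext_linear => c' d' k x y; rewrite ?pureDl ?pureDr.
rewrite /tens_mid tens_extE ?tens_extE //; split=> [T|S]; first exact: linearP.
by apply: tens_ext_linear => a' b'; exact: linearP.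
Qed.

Lemma tens_lunitE V (c : K^o) (v : V) : tens_lunit V (pure c v) = (c : K) *: v.
Proof.
apply: tens_extE; split=> ? a x y; first by rewrite scalerDl -scalerA.
by rewrite scalerDr !scalerA mulrC.
Qed.

Lemma tens_runitE V (c : K^o) (v : V) : tens_runit V (pure v c) = (c : K) *: v.
Proof.
apply: tens_extE; split=> ? a x y; last by rewrite scalerDl -scalerA.
by rewrite scalerDr !scalerA mulrC.
Qed.

Lemma tens_map_id U V : tens_map \1 \1 = \1%VF :> 'Hom(tens U V, tens U V).
Proof. by apply: tens_hom_ext => u v; rewrite tens_mapE !id_lfunE. Qed.

Lemma tens_map_comp U V U' V' U'' V'' (f' : 'Hom(U', U'')) (g' : 'Hom(V', V''))
    (f : 'Hom(U, U')) (g : 'Hom(V, V')) :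
  tens_map (f' \o f) (g' \o g) = (tens_map f' g' \o tens_map f g)%VF.
Proof. by apply: tens_hom_ext => u v; rewrite comp_lfunE !tens_mapE !comp_lfunE. Qed.

End Tensor.

(** * Hopf algebras *)

Section Hopf.
Variable K : fieldType.
Implicit Types U V W X Y Z A B C D : vectType K.

Record hopfAlg V := HopfAlg {
  hmul : 'Hom(tens V V, V);
  hcomul : 'Hom(V, tens V V);
  hunit : 'Hom(K^o, V);
  hcounit : 'Hom(V, K^o);
  hantipode : 'Hom(V, V);
  hmulA : (hmul \o tens_map hmul \1 =
           hmul \o tens_map \1 hmul \o tens_assoc V V V)%VF;
  hmul1l : (hmul \o tens_map hunit \1 = tens_lunit V)%VF;
  hmul1r : (hmul \o tens_map \1 hunit = tens_runit V)%VF;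
  hcomulA : (tens_assoc V V V \o tens_map hcomul \1 \o hcomul =
             tens_map \1 hcomul \o hcomul)%VF;
  hcounitl : (tens_lunit V \o tens_map hcounit \1 \o hcomul = \1)%VF;
  hcounitr : (tens_runit V \o tens_map \1 hcounit \o hcomul = \1)%VF;
  hcomulM : (tens_map hmul hmul \o tens_mid V V V V \o tens_map hcomul hcomul =
             hcomul \o hmul)%VF;
  hcomul1 : (hcomul \o hunit \o tens_lunit K^o = tens_map hunit hunit)%VF;
  hcounitM : (hcounit \o hmul = tens_lunit K^o \o tens_map hcounit hcounit)%VF;
  hcounit1 : (hcounit \o hunit = \1)%VF;
  hantipodel : (hmul \o tens_map hantipode \1 \o hcomul = hunit \o hcounit)%VF;
  hantipoder : (hmul \o tens_map \1 hantipode \o hcomul = hunit \o hcounit)%VF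
}.

(** * The dual Hopf algebra *)

Definition dual V : vectType K := 'Hom(V, K^o).

Lemma lfun_linearE U V (f : U -> V) : linear f -> forall x, linfun f x = f x.
Proof.
move=> lf x.
pose hL := GRing.isLinear.Build K U V *:%R f lf.
pose L : {linear U -> V} := HB.pack f hL.
exact: (lfunE L).
Qed.

Definition transpose U W (f : 'Hom(U, W)) : 'Hom(dual W, dual U) :=
  linfun (fun phi : dual W => (phi \o f)%VF : dual U).

Lemma transposeE U W (f : 'Hom(U, W)) (phi : dual W) :
  transpose f phi = (phi \o f)%VF.
Proof.
apply: lfun_linearE => a x y; apply/lfunP => u.
by rewrite !(comp_lfunE, add_lfunE, scale_lfunE).
Qed.

Lemma transpose_comp U V W (g : 'Hom(V, W)) (f : 'Hom(U, V)) :
  transpose (g \o f) = (transpose f \o transpose g)%VF.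
Proof. by apply/lfunP => phi; rewrite comp_lfunE !transposeE comp_lfunA. Qed.

Lemma transpose_id V : transpose (\1 : 'Hom(V, V)) = \1%VF.
Proof. by apply/lfunP => phi; rewrite transposeE id_lfunE comp_lfun1r. Qed.

(* phi (x) psi |-> (u (x) v |-> phi u * psi v). *)
Definition dual_tens U V : 'Hom(tens (dual U) (dual V), dual (tens U V)) :=
  tens_ext (fun (phi : dual U) (psi : dual V) =>
    (tens_lunit K^o \o tens_map phi psi)%VF : dual (tens U V)).

Lemma dual_tensE U V (phi : dual U) (psi : dual V) u v :
  (dual_tens U V (pure phi psi) : 'Hom(_, _)) (pure u v) = phi u * psi v.
Proof.
rewrite tens_extE ?comp_lfunE ?tens_mapE ?tens_lunitE //.
split=> f a x y; apply: tens_hom_ext => u' v';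
rewrite !(comp_lfunE, tens_mapE, add_lfunE, scale_lfunE, tens_lunitE).
  by rewrite scalerDl scalerA.
by rewrite scalerDr scalerA mulrC -scalerA.
Qed.

Definition dual_coord V (i : 'I_(dim V)) : dual V :=
  linfun (fun v : V => v2r v 0 i : K^o).

(* The inverse of [dual_tens]; it exists because U and V are finite-dimensional. *)
Definition dual_tens_inv U V : 'Hom(dual (tens U V), tens (dual U) (dual V)) :=
  linfun (fun F : dual (tens U V) =>
    \sum_i \sum_j ((F : 'Hom(_, _)) (pure (bvec i) (bvec j)) : K) *:
      pure (dual_coord i) (dual_coord j) : tens (dual U) (dual V)).

Lemma dual_coordE V (i : 'I_(dim V)) v : dual_coord i v = v2r v 0 i.
Proof. by apply: lfun_linearE => a x y; rewrite linearP !mxE. Qed.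

Lemma dual_sum V (phi : dual V) : phi = \sum_i (phi (bvec i) : K) *: dual_coord i.
Proof.
apply/lfunP => v; rewrite sum_lfunE [in LHS](bvec_sum v) linear_sum.
apply: eq_bigr => i _; rewrite linearZ scale_lfunE dual_coordE /=.
exact: mulrC.
Qed.

Lemma dual_tens_invE U V (F : dual (tens U V)) :
  dual_tens_inv U V F = \sum_i \sum_j ((F : 'Hom(_, _)) (pure (bvec i) (bvec j)) : K) *:
      pure (dual_coord i) (dual_coord j).
Proof.
apply: lfun_linearE => a x y; rewrite scaler_sumr -big_split.
apply: eq_bigr => i _; rewrite scaler_sumr -big_split; apply: eq_bigr => j _ /=.
by rewrite add_lfunE scale_lfunE scalerDl scalerA.
Qed.

Lemma dual_tensK U V : (dual_tens_inv U V \o dual_tens U V = \1)%VF.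
Proof.
apply: tens_hom_ext => phi psi; rewrite comp_lfunE id_lfunE dual_tens_invE.
rewrite [in RHS](dual_sum phi) [in RHS](dual_sum psi).
rewrite (linear_sumP (f := fun x => pure x _)); last by move=> ? ? ?; apply: pureDl.
apply: eq_bigr => i _; rewrite (linear_sumP (f := pure _)); last by move=> ? ? ?; apply: pureDr.
rewrite scaler_sumr; apply: eq_bigr => j _.
by rewrite dual_tensE scalerA.
Qed.

Lemma dual_tens_invK U V : (dual_tens U V \o dual_tens_inv U V = \1)%VF.
Proof.
apply/lfunP => F; rewrite comp_lfunE id_lfunE; apply: tens_hom_ext => u v.
rewrite dual_tens_invE [in RHS](bvec_sum u) [in RHS](bvec_sum v).
rewrite (linear_sumP (f := fun x => pure x _)); last by move=> ? ? ?; apply: pureDl.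
rewrite !linear_sum sum_lfunE; apply: eq_bigr => i _ /=.
rewrite (linear_sumP (f := pure _)); last by move=> ? ? ?; apply: pureDr.
rewrite linear_sum sum_lfunE [RHS]linearZ [X in _ = _ X]linear_sum.
rewrite [RHS]scaler_sumr; apply: eq_bigr => j _.
rewrite !linearZ /= scale_lfunE dual_tensE !dual_coordE /=.
have mulCA (a b f : K) : f * (a * b) = b * (a * f).
  by rewrite mulrC -mulrA mulrCA.
exact: mulCA.
Qed.

Lemma dual_tens_inj U V : injective (dual_tens U V).
Proof.
move=> x y /(congr1 (dual_tens_inv U V)).
by rewrite -!comp_lfunE dual_tensK !id_lfunE.
Qed.

Lemma dual_tens_nat U V U' V' (f : 'Hom(U, U')) (g : 'Hom(V, V')) :
  (dual_tens U V \o tens_map (transpose f) (transpose g) =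
   transpose (tens_map f g) \o dual_tens U' V')%VF.
Proof.
apply: tens_hom_ext => phi psi; rewrite !comp_lfunE tens_mapE; apply: tens_hom_ext => u v.
by rewrite dual_tensE !transposeE !comp_lfunE tens_mapE dual_tensE.
Qed.

Lemma hom_inj U W X (h : 'Hom(W, X)) (f g : 'Hom(U, W)) :
  injective h -> (h \o f = h \o g)%VF -> f = g.
Proof.
move=> ih /lfunP hfg; apply/lfunP => x; apply: ih; move: (hfg x).
by rewrite !comp_lfunE.
Qed.

Lemma tens_map1l W X Y Z (f : 'Hom(W, X)) (g : 'Hom(X, Y)) :
  tens_map (\1 : 'Hom(Z, Z)) (g \o f) = (tens_map \1 g \o tens_map \1 f)%VF.
Proof. by rewrite -tens_map_comp comp_lfun1l. Qed.
Lemma tens_map1r W X Y Z (f : 'Hom(W, X)) (g : 'Hom(X, Y)) :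
  tens_map (g \o f) (\1 : 'Hom(Z, Z)) = (tens_map g \1 \o tens_map f \1)%VF.
Proof. by rewrite -tens_map_comp comp_lfun1l. Qed.


Lemma pure_linl U W X (f : 'Hom(tens U W, X)) (w : W) u : 
  linfun (fun u => f (pure u w)) u = f (pure u w).
Proof. by apply: lfun_linearE => a x y; rewrite pureDl linearP. Qed.

Lemma pure_linr U W X (f : 'Hom(tens U W, X)) (u : U) w :
  linfun (fun w => f (pure u w)) w = f (pure u w).
Proof. by apply: lfun_linearE => a x y; rewrite pureDr linearP. Qed.

Lemma tens_hom_extl U V W X (f g : 'Hom(tens (tens U V) W, X)) :
  (forall u v w, f (pure (pure u v) w) = g (pure (pure u v) w)) -> f = g.
Proof.
move=> fg; apply: tens_hom_ext => T w; rewrite -!pure_linl; move: T; apply/lfunP.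
by apply: tens_hom_ext => u v; rewrite !pure_linl.
Qed.

Lemma tens_hom_extr U V W X (f g : 'Hom(tens U (tens V W), X)) :
  (forall u v w, f (pure u (pure v w)) = g (pure u (pure v w))) -> f = g.
Proof.
move=> fg; apply: tens_hom_ext => u T; rewrite -!pure_linr; move: T; apply/lfunP.
by apply: tens_hom_ext => v w; rewrite !pure_linr.
Qed.

Lemma tens_hom_ext4 U V W X Y (f g : 'Hom(tens (tens U V) (tens W X), Y)) :
  (forall u v w x, f (pure (pure u v) (pure w x)) = g (pure (pure u v) (pure w x))) ->
  f = g.
Proof.
move=> fg; apply: tens_hom_extl => u v T; rewrite -!pure_linr; move: T; apply/lfunP.
by apply: tens_hom_ext => w x; rewrite !pure_linr.
Qed.

Lemma dual_assoc U W X :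
  (transpose (tens_assoc U W X) \o dual_tens U (tens W X) \o
     tens_map \1 (dual_tens W X) \o tens_assoc (dual U) (dual W) (dual X) =
   dual_tens (tens U W) X \o tens_map (dual_tens U W) \1)%VF.
Proof.
apply: tens_hom_extl => phi psi chi.
rewrite !comp_lfunE tens_assocE !tens_mapE !id_lfunE transposeE.
apply: tens_hom_extl => u v w.
by rewrite comp_lfunE tens_assocE !dual_tensE mulrA.
Qed.

Lemma dual_mid A B C D :
  (dual_tens (tens A C) (tens B D) \o tens_map (dual_tens A C) (dual_tens B D) \o
     tens_mid (dual A) (dual B) (dual C) (dual D) =
   transpose (tens_mid A C B D) \o dual_tens (tens A B) (tens C D) \o
     tens_map (dual_tens A B) (dual_tens C D))%VF.
Proof.
apply: tens_hom_ext4 => a b c d.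
rewrite !comp_lfunE tens_midE !tens_mapE transposeE.
apply: tens_hom_ext4 => u v w x.
by rewrite comp_lfunE tens_midE !dual_tensE mulrACA.
Qed.

Variable V : vectType K.
Variable H : hopfAlg V.

Definition dmul_map : 'Hom(tens (dual V) (dual V), dual V) :=
  (transpose (hcomul H) \o dual_tens V V)%VF.
Definition dcomul_map : 'Hom(dual V, tens (dual V) (dual V)) :=
  (dual_tens_inv V V \o transpose (hmul H))%VF.
Definition dunit_map : 'Hom(K^o, dual V) :=
  linfun (fun c : K^o => (c : K) *: (hcounit H : dual V)).
Definition dcounit_map : 'Hom(dual V, K^o) :=
  linfun (fun phi : dual V => (phi : 'Hom(_, _)) (hunit H 1)).

Lemma dunit_mapE c : dunit_map c = (c : K) *: (hcounit H : dual V).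
Proof. by apply: lfun_linearE => a x y; rewrite scalerDl scalerA. Qed.

Lemma dcounit_mapE phi : dcounit_map phi = (phi : 'Hom(_, _)) (hunit H 1).
Proof. by apply: lfun_linearE => a x y; rewrite add_lfunE scale_lfunE. Qed.

Lemma dcomul_mapK : (dual_tens V V \o dcomul_map)%VF = transpose (hmul H).
Proof. by rewrite comp_lfunA dual_tens_invK comp_lfun1l. Qed.

Lemma dual_mulA :
  (dmul_map \o tens_map dmul_map \1 =
   dmul_map \o tens_map \1 dmul_map \o tens_assoc _ _ _)%VF.
Proof.
rewrite /dmul_map tens_map1l tens_map1r -!comp_lfunA -!transpose_id.
rewrite ![(dual_tens V V \o (tens_map _ _ \o _))%VF]comp_lfunA !dual_tens_nat.
rewrite -!comp_lfunA !transpose_id -dual_assoc !comp_lfunA -!transpose_comp.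
by rewrite (comp_lfunA (tens_assoc V V V)) hcomulA.
Qed.

Lemma dual_mul1l : (dmul_map \o tens_map dunit_map \1 = tens_lunit _)%VF.
Proof.
apply: tens_hom_ext => c phi.
rewrite !comp_lfunE tens_mapE id_lfunE tens_lunitE transposeE dunit_mapE.
have -> : dual_tens V V (pure (c *: (hcounit H : dual V)) phi) =
    c *: (phi \o (tens_lunit V \o tens_map (hcounit H) \1))%VF.
  apply: tens_hom_ext => u v.
  rewrite dual_tensE !scale_lfunE !comp_lfunE tens_mapE id_lfunE tens_lunitE linearZ.
  exact/esym/mulrA.
by rewrite comp_lfunZl -comp_lfunA hcounitl comp_lfun1r.
Qed.

Lemma dual_mul1r : (dmul_map \o tens_map \1 dunit_map = tens_runit _)%VF.
Proof.
apply: tens_hom_ext => phi c.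
rewrite !comp_lfunE tens_mapE id_lfunE tens_runitE transposeE dunit_mapE.
have -> : dual_tens V V (pure phi (c *: (hcounit H : dual V))) =
    c *: (phi \o (tens_runit V \o tens_map \1 (hcounit H)))%VF.
  apply: tens_hom_ext => u v.
  rewrite dual_tensE !scale_lfunE !comp_lfunE tens_mapE id_lfunE tens_runitE linearZ.
  have mulCA (x y z : K) : x * (y * z) = y * (z * x) by rewrite mulrC mulrA.
  exact: mulCA.
by rewrite comp_lfunZl -comp_lfunA hcounitr comp_lfun1r.
Qed.

Lemma dual_comulA :
  (tens_assoc _ _ _ \o tens_map dcomul_map \1 \o dcomul_map =
   tens_map \1 dcomul_map \o dcomul_map)%VF.
Proof.
have tinj : injective (transpose (tens_assoc V V V)).
  move=> F G; rewrite !transposeE => /lfunP FG; apply: tens_hom_extr => u v w.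
  by have := FG (pure (pure u v) w); rewrite !comp_lfunE !tens_assocE.
have dinj : injective (tens_map (\1 : 'Hom(dual V, dual V)) (dual_tens V V)).
  apply: (can_inj (g := tens_map \1 (dual_tens_inv V V))) => x.
  by rewrite -comp_lfunE -tens_map1l dual_tensK tens_map_id id_lfunE.
apply: (hom_inj dinj); apply: (hom_inj (@dual_tens_inj _ _)); apply: (hom_inj tinj).
rewrite !comp_lfunA dual_assoc -!comp_lfunA.
rewrite ![(tens_map _ _ \o (tens_map _ _ \o _))%VF]comp_lfunA -tens_map1l -tens_map1r.
rewrite dcomul_mapK -!transpose_id.
rewrite ![(dual_tens _ _ \o (tens_map _ _ \o _))%VF]comp_lfunA !dual_tens_nat.
by rewrite -!comp_lfunA dcomul_mapK -!transpose_comp hmulA.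
Qed.

Lemma dual_counitl : (tens_lunit _ \o tens_map dcounit_map \1 \o dcomul_map = \1)%VF.
Proof.
pose ins : 'Hom(V, tens V V) := linfun (pure (hunit H 1)).
have insE x : ins x = pure (hunit H 1) x.
  by apply: lfun_linearE => a y z; rewrite pureDr.
have -> : (tens_lunit _ \o tens_map dcounit_map \1 = transpose ins \o dual_tens V V)%VF.
  apply: tens_hom_ext => phi psi; rewrite !comp_lfunE tens_mapE id_lfunE tens_lunitE.
  rewrite dcounit_mapE transposeE; apply/lfunP => x.
  by rewrite comp_lfunE insE dual_tensE scale_lfunE.
rewrite -comp_lfunA dcomul_mapK -transpose_comp -transpose_id; congr transpose.
apply/lfunP => x; rewrite comp_lfunE insE id_lfunE.
have /lfunP/(_ (pure (1 : K^o) x)) := hmul1l H.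
by rewrite comp_lfunE tens_mapE id_lfunE tens_lunitE scale1r.
Qed.

Lemma dual_counitr : (tens_runit _ \o tens_map \1 dcounit_map \o dcomul_map = \1)%VF.
Proof.
pose ins : 'Hom(V, tens V V) := linfun (fun x => pure x (hunit H 1)).
have insE x : ins x = pure x (hunit H 1).
  by apply: lfun_linearE => a y z; rewrite pureDl.
have -> : (tens_runit _ \o tens_map \1 dcounit_map = transpose ins \o dual_tens V V)%VF.
  apply: tens_hom_ext => phi psi; rewrite !comp_lfunE tens_mapE id_lfunE tens_runitE.
  rewrite dcounit_mapE transposeE; apply/lfunP => x.
  by rewrite comp_lfunE insE dual_tensE scale_lfunE mulrC.
rewrite -comp_lfunA dcomul_mapK -transpose_comp -transpose_id; congr transpose.
apply/lfunP => x; rewrite comp_lfunE insE id_lfunE.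
have /lfunP/(_ (pure x (1 : K^o))) := hmul1r H.
by rewrite comp_lfunE tens_mapE id_lfunE tens_runitE scale1r.
Qed.

Lemma dual_comulM :
  (tens_map dmul_map dmul_map \o tens_mid _ _ _ _ \o tens_map dcomul_map dcomul_map =
   dcomul_map \o dmul_map)%VF.
Proof.
apply: (hom_inj (@dual_tens_inj _ _)).
rewrite [RHS]comp_lfunA dcomul_mapK /dmul_map tens_map_comp -!comp_lfunA.
rewrite [LHS]comp_lfunA dual_tens_nat -!comp_lfunA.
rewrite [X in (_ \o X)%VF = _]comp_lfunA [X in (_ \o X)%VF = _]comp_lfunA.
rewrite dual_mid -!comp_lfunA.
rewrite -tens_map_comp dcomul_mapK dual_tens_nat.
by rewrite !comp_lfunA -!transpose_comp !comp_lfunA hcomulM.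
Qed.

Lemma dual_comul1 :
  (dcomul_map \o dunit_map \o tens_lunit K^o = tens_map dunit_map dunit_map)%VF.
Proof.
apply: (hom_inj (@dual_tens_inj _ _)).
rewrite -(comp_lfunA dcomul_map) [LHS]comp_lfunA dcomul_mapK.
apply: tens_hom_ext => c d.
rewrite !comp_lfunE tens_mapE tens_lunitE !dunit_mapE transposeE.
apply: tens_hom_ext => u v; rewrite comp_lfunE dual_tensE !scale_lfunE.
rewrite -[hcounit H (hmul H _)]comp_lfunE hcounitM comp_lfunE tens_mapE tens_lunitE.
have mulACA (a b x y : K) : a * b * (x * y) = a * x * (b * y) by rewrite mulrACA.
exact: mulACA.
Qed.

Lemma dual_counitM :
  (dcounit_map \o dmul_map = tens_lunit K^o \o tens_map dcounit_map dcounit_map)%VF.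
Proof.
apply: tens_hom_ext => phi psi.
rewrite !comp_lfunE tens_mapE tens_lunitE !dcounit_mapE transposeE comp_lfunE.
have /lfunP/(_ (pure (1 : K^o) (1 : K^o))) := hcomul1 H.
by rewrite !comp_lfunE tens_mapE tens_lunitE scale1r => ->; rewrite dual_tensE.
Qed.

Lemma dual_counit1 : (dcounit_map \o dunit_map = \1)%VF.
Proof.
apply/lfunP => c; rewrite comp_lfunE dcounit_mapE dunit_mapE scale_lfunE id_lfunE.
by rewrite -comp_lfunE hcounit1 id_lfunE; exact: mulr1.
Qed.

Lemma dual_unit_counit : (dunit_map \o dcounit_map = transpose (hunit H \o hcounit H))%VF.
Proof.
apply/lfunP => phi; rewrite comp_lfunE dunit_mapE dcounit_mapE transposeE.
apply/lfunP => x; rewrite scale_lfunE !comp_lfunE.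
rewrite -{2}[hcounit H x]mulr1 -[_ * 1]/(_ *: (1 : K^o)) !linearZ /=.
exact: mulrC.
Qed.

Lemma dual_antipodel :
  (dmul_map \o tens_map (transpose (hantipode H)) \1 \o dcomul_map =
   dunit_map \o dcounit_map)%VF.
Proof.
rewrite dual_unit_counit /dmul_map -transpose_id -(comp_lfunA (transpose (hcomul H))).
rewrite dual_tens_nat -!comp_lfunA dcomul_mapK.
by rewrite -!transpose_comp -(hantipodel H).
Qed.

Lemma dual_antipoder :
  (dmul_map \o tens_map \1 (transpose (hantipode H)) \o dcomul_map =
   dunit_map \o dcounit_map)%VF.
Proof.
rewrite dual_unit_counit /dmul_map -transpose_id -(comp_lfunA (transpose (hcomul H))).
rewrite dual_tens_nat -!comp_lfunA dcomul_mapK.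
by rewrite -!transpose_comp -(hantipoder H).
Qed.

Definition dual_hopf : hopfAlg (dual V) := {|
  hmul := dmul_map;
  hcomul := dcomul_map;
  hunit := dunit_map;
  hcounit := dcounit_map;
  hantipode := transpose (hantipode H);
  hmulA := dual_mulA;
  hmul1l := dual_mul1l;
  hmul1r := dual_mul1r;
  hcomulA := dual_comulA;
  hcounitl := dual_counitl;
  hcounitr := dual_counitr;
  hcomulM := dual_comulM;
  hcomul1 := dual_comul1;
  hcounitM := dual_counitM;
  hcounit1 := dual_counit1;
  hantipodel := dual_antipodel;
  hantipoder := dual_antipoder
|}.

End Hopf.

(** * Formal power series of linear maps *)

Section Series.
Variable K : fieldType.
Implicit Types U V W X : vectType K.

(* Since V is finite-dimensional, V (x) K[[t]] is the space of sequences in V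
   (coefficients of t^n), and K[[t]]-linear maps U[[t]] -> V[[t]] are the
   series of linear maps U -> V, acting by [fapp]. *)
Definition fser U V := nat -> 'Hom(U, V).

Definition fapp U V (f : fser U V) (x : nat -> U) : nat -> V :=
  fun n => \sum_(i < n.+1) f i (x (n - i)%N).

Definition fscale V (a : nat -> K) (x : nat -> V) : nat -> V :=
  fun n => \sum_(i < n.+1) a i *: x (n - i)%N.

Definition fpure U V (x : nat -> U) (y : nat -> V) : nat -> tens U V :=
  fun n => \sum_(i < n.+1) pure (x i) (y (n - i)%N).

Definition fconst U V (f : 'Hom(U, V)) : fser U V :=
  fun n => if n == 0%N then f else 0.

Definition fcomp U V W (g : fser V W) (f : fser U V) : fser U W :=
  fun n => \sum_(i < n.+1) (g i \o f (n - i)%N)%VF.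

Definition ftens U V U' V' (f : fser U U') (g : fser V V') :
    fser (tens U V) (tens U' V') :=
  fun n => \sum_(i < n.+1) tens_map (f i) (g (n - i)%N).

Lemma sum_tri (Z : zmodType) (F : nat -> nat -> Z) n :
  \sum_(i < n.+1) \sum_(j < (n - i).+1) F i j =
  \sum_(j < n.+1) \sum_(i < (n - j).+1) F i j.
Proof.
have E (G : nat -> nat -> Z) : \sum_(i < n.+1) \sum_(j < (n - i).+1) G i j =
    \sum_(i < n.+1) \sum_(j < n.+1 | (i + j <= n)%N) G i j.
  apply: eq_bigr => i _; rewrite (big_ord_widen n.+1 (G i)) ?ltnS ?leq_subr //.
  by apply: eq_bigl => j; rewrite ltnS leq_subRL // -ltnS ltn_ord.
rewrite E (E (fun j i => F i j)) (exchange_big_dep predT) //=.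
by apply: eq_bigr => j _; apply: eq_bigl => i; rewrite addnC.
Qed.

Lemma sum_conv (Z : zmodType) (F : nat -> nat -> nat -> Z) n :
  \sum_(i < n.+1) \sum_(j < i.+1) F j (i - j)%N (n - i)%N =
  \sum_(j < n.+1) \sum_(k < (n - j).+1) F j k (n - j - k)%N.
Proof.
transitivity (\sum_(i < n.+1) \sum_(j < n.+1 | (j <= i)%N) F j (i - j)%N (n - i)%N).
  by apply: eq_bigr => i _; rewrite (big_ord_widen n.+1 (fun j => F j (i - j)%N (n - i)%N)).
rewrite (exchange_big_dep predT) //=; apply: eq_bigr => j _.
rewrite -(big_geq_mkord _ _ predT (fun i => F j (i - j)%N (n - i)%N)) -{1}[val j]add0n big_addn.
rewrite subSn; last by rewrite -ltnS ltn_ord.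
rewrite big_mkord.
by apply: eq_bigr => k _; rewrite addnK addnC subnDA.
Qed.

Lemma fapp_fcomp U V W (g : fser V W) (f : fser U V) x :
  fapp (fcomp g f) x =1 fapp g (fapp f x).
Proof.
move=> n; rewrite /fapp /fcomp.
transitivity (\sum_(i < n.+1) \sum_(j < i.+1) g j (f (i - j)%N (x (n - i)%N))).
  apply: eq_bigr => i _; rewrite sum_lfunE; apply: eq_bigr => j _.
  by rewrite comp_lfunE.
rewrite (sum_conv (fun a b c => g a (f b (x c)))); apply: eq_bigr => j _.
by rewrite linear_sum.
Qed.

Lemma fapp_linear U V (f : fser U V) a (x y : nat -> U) :
  fapp f (fun n => fscale a x n + y n) =1 (fun n => fscale a (fapp f x) n + fapp f y n).
Proof.
move=> n; rewrite /fapp /fscale.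
rewrite (eq_bigr (fun i : 'I_n.+1 =>
   \sum_(j < (n - i).+1) a j *: f i (x (n - i - j)%N) + f i (y (n - i)%N))); last first.
  by move=> i _; rewrite linearD linear_sum; congr (_ + _); apply: eq_bigr => j _; rewrite linearZ.
rewrite big_split; congr (_ + _).
rewrite (sum_tri (fun i j => a j *: f i (x (n - i - j)%N))).
apply: eq_bigr => j _; rewrite scaler_sumr; apply: eq_bigr => i _.
by rewrite -!subnDA addnC.
Qed.

Lemma fapp_ftens U V U' V' (f : fser U U') (g : fser V V') x y :
  fapp (ftens f g) (fpure x y) =1 fpure (fapp f x) (fapp g y).
Proof.
move=> n; rewrite /fapp /ftens /fpure.
pose F a b c d : tens U' V' := pure (f a (x c)) (g b (y d)).
transitivity (\sum_(i < n.+1) \sum_(j < i.+1)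
    \sum_(k < (n - i).+1) F j (i - j)%N k (n - i - k)%N).
  apply: eq_bigr => i _; rewrite sum_lfunE; apply: eq_bigr => j _.
  by rewrite linear_sum; apply: eq_bigr => k _ /=; rewrite tens_mapE.
rewrite (sum_conv (fun a b m => \sum_(k < m.+1) F a b k (m - k)%N)).
transitivity (\sum_(i < n.+1) \sum_(j < i.+1)
    \sum_(k < (n - i).+1) F j k (i - j)%N (n - i - k)%N).
  rewrite (sum_conv (fun a b m => \sum_(k < m.+1) F a k b (m - k)%N)).
  apply: eq_bigr => j _.
  rewrite (sum_tri (fun b k => F j b k (n - j - b - k)%N)).
  apply: eq_bigr => k _; apply: eq_bigr => b _; congr (F _ _ _ _).
  exact: subnAC.
apply: eq_bigr => i _.
have suml (w : V') m (z : nat -> U') :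
    pure (\sum_(k < m) z k) w = \sum_(k < m) pure (z k) w.
  by rewrite /pure linear_sum linear_sum mulmx_suml.
have sumr (w : U') m (z : nat -> V') :
    pure w (\sum_(k < m) z k) = \sum_(k < m) pure w (z k).
  by rewrite /pure linear_sum mulmx_sumr.
rewrite (suml _ _ (fun k => f k (x (i - k)%N))); apply: eq_bigr => j _.
by rewrite (sumr _ _ (fun k => g k (y (n - i - k)%N))).
Qed.

Lemma fapp_inj U V (f g : fser U V) : (forall x, fapp f x =1 fapp g x) -> f =1 g.
Proof.
move=> fg n; apply/lfunP => u.
have E (h : fser U V) : fapp h (fun k => if k == 0%N then u else 0) n = h n u.
  rewrite /fapp (bigD1 ord_max) //= subnn eqxx big1 ?addr0 // => i ni.
  have: (n - i != 0)%N.
    rewrite subn_eq0 -ltnNge ltn_neqAle -ltnS ltn_ord andbT.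
    by apply: contra ni => /eqP e; apply/eqP/val_inj.
  by move/negbTE->; rewrite linear0.
by rewrite -!E fg.
Qed.

Lemma fapp_fconst U V (f : 'Hom(U, V)) x : fapp (fconst f) x =1 (fun n => f (x n)).
Proof.
move=> n; rewrite /fapp big_ord_recl subn0 /= big1 ?addr0 // => i _.
by rewrite /fconst /= lfunE.
Qed.

Lemma eq_fcomp U V W (g g' : fser V W) (f f' : fser U V) :
  g =1 g' -> f =1 f' -> fcomp g f =1 fcomp g' f'.
Proof. by move=> gg ff n; apply: eq_bigr => i _; rewrite gg ff. Qed.

Lemma fcomp_const U V W (g : 'Hom(V, W)) (f : 'Hom(U, V)) :
  fcomp (fconst g) (fconst f) =1 fconst (g \o f)%VF.
Proof.
move=> n; rewrite /fcomp big_ord_recl subn0 /= big1 ?addr0 => [|i _].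
  by rewrite /fconst /=; case: eqP => // _; rewrite comp_lfun0r.
by rewrite /fconst /= comp_lfun0l.
Qed.

Lemma ftens_const U V U' V' (f : 'Hom(U, U')) (g : 'Hom(V, V')) :
  ftens (fconst f) (fconst g) =1 fconst (tens_map f g).
Proof.
have t0l (g' : 'Hom(V, V')) : tens_map (0 : 'Hom(U, U')) g' = 0.
  apply: tens_hom_ext => u v; rewrite tens_mapE !zero_lfunE.
  by rewrite /pure linear0 trmx0 mul0mx.
have t0r (f' : 'Hom(U, U')) : tens_map f' (0 : 'Hom(V, V')) = 0.
  apply: tens_hom_ext => u v; rewrite tens_mapE !zero_lfunE.
  by rewrite /pure linear0 mulmx0.
move=> n; rewrite /ftens big_ord_recl subn0 /= big1 ?addr0 => [|i _].
  by rewrite /fconst /=; case: eqP.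
by rewrite /fconst /=.
Qed.

Lemma fcompC U V W (g : fser V W) (f : fser U V) b a :
  g =1 fconst b -> f =1 fconst a -> fcomp g f =1 fconst (b \o a)%VF.
Proof. by move=> gb fa n; rewrite (eq_fcomp gb fa) fcomp_const. Qed.

Lemma ftensC U V U' V' (f : fser U U') (g : fser V V') a b :
  f =1 fconst a -> g =1 fconst b -> ftens f g =1 fconst (tens_map a b).
Proof.
move=> fa gb n; rewrite -ftens_const.
by apply: eq_bigr => i _; rewrite fa gb.
Qed.

Lemma fconst_eq2 U V (f g : fser U V) a b :
  f =1 fconst a -> g =1 fconst b -> a = b -> f =1 g.
Proof. by move=> fa gb ab n; rewrite fa gb ab. Qed.

End Series.

(** * Deformations and rigidity *)

Section Rigid.
Variable K : fieldType.
Variable V : vectType K.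

(* The series make V[[t]] a bialgebra (in fact a Hopf algebra) over K[[t]]
   whose unit, counit and antipode are the ones of H. *)
Record deformation (H : hopfAlg V) := Deformation {
  fmul : fser (tens V V) V;
  fcomul : fser V (tens V V);
  fmul_0 : fmul 0%N = hmul H;
  fcomul_0 : fcomul 0%N = hcomul H;
  fmulA : fcomp fmul (ftens fmul (fconst \1%VF)) =1
          fcomp (fcomp fmul (ftens (fconst \1%VF) fmul)) (fconst (tens_assoc V V V));
  fcomulA : fcomp (fconst (tens_assoc V V V))
              (fcomp (ftens fcomul (fconst \1%VF)) fcomul) =1
            fcomp (ftens (fconst \1%VF) fcomul) fcomul;
  fcomulM : fcomp (ftens fmul fmul)
              (fcomp (fconst (tens_mid V V V V)) (ftens fcomul fcomul)) =1
            fcomp fcomul fmul;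
  fmul1l : fcomp fmul (ftens (fconst (hunit H)) (fconst \1%VF)) =1
           fconst (tens_lunit V);
  fmul1r : fcomp fmul (ftens (fconst \1%VF) (fconst (hunit H))) =1
           fconst (tens_runit V);
  fcounitl : fcomp (fconst (tens_lunit V))
               (fcomp (ftens (fconst (hcounit H)) (fconst \1%VF)) fcomul) =1
             fconst \1%VF;
  fcounitr : fcomp (fconst (tens_runit V))
               (fcomp (ftens (fconst \1%VF) (fconst (hcounit H))) fcomul) =1
             fconst \1%VF;
  fcomul1 : fcomp fcomul (fconst (hunit H \o tens_lunit K^o)%VF) =1
            ftens (fconst (hunit H)) (fconst (hunit H));
  fcounitM : fcomp (fconst (hcounit H)) fmul =1
             fconst (tens_lunit K^o \o tens_map (hcounit H) (hcounit H))%VF;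
  fantipodel : fcomp fmul (fcomp (ftens (fconst (hantipode H)) (fconst \1%VF)) fcomul) =1
               fconst (hunit H \o hcounit H)%VF;
  fantipoder : fcomp fmul (fcomp (ftens (fconst \1%VF) (fconst (hantipode H))) fcomul) =1
               fconst (hunit H \o hcounit H)%VF
}.

Definition const_deformation (H : hopfAlg V) : deformation H.
Proof.
by refine (@Deformation H (fconst (hmul H)) (fconst (hcomul H)) erefl erefl
  _ _ _ _ _ _ _ _ _ _ _);
  (apply: fconst_eq2; first by repeat (apply: fcompC || apply: ftensC || done));
  (try by repeat (apply: fcompC || apply: ftensC || done));
  rewrite ?comp_lfunA ?hmulA ?hmul1l ?hmul1r ?hcomulA ?hcounitl ?hcounitr ?hcomulM
    ?hcomul1 ?hcounitM ?hantipodel ?hantipoder.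
Defined.

(* psi is the inverse phi_t^-1 of phi_t; it exists and is unique because
   phi_t has constant term the identity. *)
Definition equivalent (H : hopfAlg V) (D D' : deformation H) : Prop :=
  exists phi psi : fser V V,
    [/\ phi 0%N = \1%VF,
        fcomp phi psi =1 fconst \1%VF /\ fcomp psi phi =1 fconst \1%VF,
        fmul D' =1 fcomp psi (fcomp (fmul D) (ftens phi phi)) &
        fcomul D' =1 fcomp (ftens psi psi) (fcomp (fcomul D) phi)].

Definition trivial_deformation (H : hopfAlg V) (D : deformation H) : Prop :=
  equivalent D (const_deformation H).

Definition rigid (H : hopfAlg V) : Prop :=
  forall D : deformation H, trivial_deformation D.

End Rigid.

(* Main.v *)
(** In finite dimension, transposition is a bijection from the linear maps
    [U -> W] to the linear maps [W* -> U*], also coefficientwise for formal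
    series.  Let [d : V* (x) V* -> (V (x) V)*] be the canonical isomorphism.
    A deformation [(M, C)] of [H*] is then the transpose of a unique pair
    [(m, delta)] of series on [V], with [m^T = d C] and [delta^T d = M], and
    the transposed axioms say that [(m, delta)] deforms [H].  If [phi]
    trivialises [(m, delta)], then the transpose of [phi^-1] trivialises
    [(M, C)]. *)

Require Import Defs.
From Stdlib Require Import FunctionalExtensionality.
From mathcomp Require Import all_boot all_order all_algebra.

Set Implicit Arguments.
Unset Strict Implicit.
Unset Printing Implicit Defensive.

Import GRing.Theory VectorInternalTheory.
Local Open Scope ring_scope.

(** * Transposition of linear maps, and its compatibility with tensor products and scalars *)

Section Transpose.
Variable K : fieldType.
Implicit Types U V W X : vectType K.

(** The coordinate functionals [dual_coord i] separate the points of [W], so [f] is recovered from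
    the functionals [dual_coord i \o f]. *)
Lemma transpose_inj U W : injective (@transpose K U W).
Proof.
move=> f g fg; apply/lfunP => u; apply: v2r_inj.
apply/rowP => i; rewrite -!dual_coordE -!comp_lfunE.
by move/lfunP: fg => /(_ (dual_coord i)); rewrite !transposeE => ->.
Qed.

Lemma transpose_linear U W : linear (@transpose K U W).
Proof.
move=> a f g; apply/lfunP => phi; apply/lfunP => u.
by rewrite add_lfunE scale_lfunE !transposeE !(comp_lfunE, add_lfunE, scale_lfunE) linearP.
Qed.

Lemma transpose_sum U W n (f : 'I_n -> 'Hom(U, W)) :
  transpose (\sum_i f i) = \sum_i transpose (f i).
Proof.
have := linear_sumP (@transpose_linear U W) (fun=> 1) f.
by under eq_bigr do rewrite scale1r; under [RHS]eq_bigr do rewrite scale1r.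
Qed.

Lemma transpose0 U W : transpose (0 : 'Hom(U, W)) = 0.
Proof. by have := @transpose_sum U W 0 (fun=> 0); rewrite !big_ord0. Qed.

(** If [g] is the transpose of [f], then [g (dual_coord i)] is the [i]-th coordinate of [f]; the
    formula reassembles [f] from these coordinates. *)
Definition untranspose U W (g : 'Hom(dual W, dual U)) : 'Hom(U, W) :=
  linfun (fun u => \sum_i ((g (dual_coord i) : 'Hom(_, _)) u : K) *: bvec i).

Lemma untransposeE U W (g : 'Hom(dual W, dual U)) u :
  untranspose g u = \sum_i ((g (dual_coord i) : 'Hom(_, _)) u : K) *: bvec i.
Proof.
apply: lfun_linearE => a x y; rewrite scaler_sumr -big_split.
by apply: eq_bigr => i _; rewrite linearP /= scalerDl scalerA.
Qed.

Lemma untransposeK U W : cancel (@untranspose U W) (@transpose K U W).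
Proof.
move=> g; apply/lfunP => phi; rewrite transposeE; apply/lfunP => u.
rewrite comp_lfunE untransposeE [in RHS](dual_sum phi) !linear_sum sum_lfunE.
by apply: eq_bigr => i _; rewrite !linearZ scale_lfunE; apply: mulrC.
Qed.

(** Surjectivity of a structural map in the form of right cancellation, the form that passes
    coefficientwise to series through [fcomp_const_epi]. The next three lemmas serve the same
    purpose. *)
Lemma tens_assoc_epi U V W X (f g : 'Hom(tens U (tens V W), X)) :
  (f \o tens_assoc U V W = g \o tens_assoc U V W)%VF -> f = g.
Proof.
move=> fg; apply: tens_hom_extr => u v w; rewrite -tens_assocE.
by rewrite -!comp_lfunE fg.
Qed.

Lemma tens_lunit_epi V X (f g : 'Hom(V, X)) :
  (f \o tens_lunit V = g \o tens_lunit V)%VF -> f = g.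
Proof.
move=> /lfunP fg; apply/lfunP => v; have := fg (pure (1 : K^o) v).
by rewrite !comp_lfunE tens_lunitE scale1r.
Qed.

Lemma tens_runit_epi V X (f g : 'Hom(V, X)) :
  (f \o tens_runit V = g \o tens_runit V)%VF -> f = g.
Proof.
move=> /lfunP fg; apply/lfunP => v; have := fg (pure v (1 : K^o)).
by rewrite !comp_lfunE tens_runitE scale1r.
Qed.

Lemma dual_tens_epi U V X (f g : 'Hom(dual (tens U V), X)) :
  (f \o dual_tens U V = g \o dual_tens U V)%VF -> f = g.
Proof.
move/(congr1 (fun h => h \o dual_tens_inv U V)%VF).
by rewrite -!comp_lfunA dual_tens_invK !comp_lfun1r.
Qed.

(** Evaluation at 1 identifies the dual of the ground field with the field. Transposes of units and
    counits involve [dual K^o], whereas the structure maps of [dual_hopf] use [K^o]. *)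
Definition dual_scalar : 'Hom(dual K^o, K^o) :=
  linfun (fun phi : dual K^o => (phi : 'Hom(_, _)) 1).

Definition scalar_dual : 'Hom(K^o, dual K^o) :=
  linfun (fun c : K^o => (c : K) *: (\1%VF : dual K^o)).

Lemma dual_scalarE phi : dual_scalar phi = (phi : 'Hom(_, _)) 1.
Proof. by apply: lfun_linearE => a x y; rewrite add_lfunE scale_lfunE. Qed.

Lemma scalar_dualE c : scalar_dual c = (c : K) *: (\1%VF : dual K^o).
Proof. by apply: lfun_linearE => a x y; rewrite scalerDl scalerA. Qed.

Lemma lfun_scalarE (phi : dual K^o) (c : K) :
  (phi : 'Hom(_, _)) c = c * (phi : 'Hom(_, _)) 1.
Proof. by rewrite -{1}(mulr1 c) -[c * 1]/(c *: (1 : K^o)) linearZ. Qed.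

Lemma scalar_dualK : (dual_scalar \o scalar_dual = \1)%VF.
Proof.
apply/lfunP => c; rewrite comp_lfunE dual_scalarE scalar_dualE scale_lfunE.
by rewrite !id_lfunE; apply: mulr1.
Qed.

Lemma dual_scalarK : (scalar_dual \o dual_scalar = \1)%VF.
Proof.
apply/lfunP => phi; rewrite comp_lfunE dual_scalarE scalar_dualE id_lfunE.
apply/lfunP => c; rewrite scale_lfunE id_lfunE [RHS]lfun_scalarE; exact: mulrC.
Qed.

(** Compatibility of [dual_tens] with the left unit constraint, modulo [dual_scalar]; it turns unit
    axioms into counit axioms and conversely. *)
Lemma dual_lunit V :
  dual_tens K^o V =
  (transpose (tens_lunit V) \o (tens_lunit (dual V) \o tens_map dual_scalar \1))%VF.
Proof.
apply: tens_hom_ext => phi psi; apply: tens_hom_ext => c v.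
rewrite !comp_lfunE transposeE comp_lfunE tens_mapE id_lfunE !tens_lunitE dual_tensE.
rewrite scale_lfunE linearZ dual_scalarE [phi c]lfun_scalarE [RHS]mulrCA.
exact/esym/mulrA.
Qed.

Lemma dual_runit V :
  dual_tens V K^o =
  (transpose (tens_runit V) \o (tens_runit (dual V) \o tens_map \1 dual_scalar))%VF.
Proof.
apply: tens_hom_ext => psi phi; apply: tens_hom_ext => v c.
rewrite !comp_lfunE transposeE comp_lfunE tens_mapE id_lfunE !tens_runitE dual_tensE.
rewrite scale_lfunE linearZ dual_scalarE [phi c]lfun_scalarE mulrC [RHS]mulrCA.
exact/esym/mulrA.
Qed.

Lemma dual_lunit_scalar :
  dual_tens K^o K^o =
  (transpose (tens_lunit K^o) \o
     (scalar_dual \o (tens_lunit K^o \o tens_map dual_scalar dual_scalar)))%VF.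
Proof.
rewrite dual_lunit; congr (_ \o _)%VF; apply: tens_hom_ext => phi psi.
rewrite !comp_lfunE !tens_mapE id_lfunE !tens_lunitE linearZ /= dual_scalarE.
by rewrite -[X in _ = _ *: X]comp_lfunE dual_scalarK id_lfunE.
Qed.

Lemma dcounit_transpose V (H : hopfAlg V) :
  dcounit_map H = (dual_scalar \o transpose (hunit H))%VF.
Proof.
by apply/lfunP => phi; rewrite dcounit_mapE comp_lfunE transposeE dual_scalarE comp_lfunE.
Qed.

Lemma dunit_transpose V (H : hopfAlg V) :
  dunit_map H = (transpose (hcounit H) \o scalar_dual)%VF.
Proof.
apply/lfunP => c; rewrite dunit_mapE comp_lfunE transposeE scalar_dualE.
by rewrite -comp_lfunZl comp_lfun1l.
Qed.

End Transpose.

Arguments dual_scalar {K}.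
Arguments scalar_dual {K}.

(** * Algebra of series of linear maps: composition, tensor product, transposition *)

Section SeriesAlgebra.
Variable K : fieldType.
Implicit Types U V W X Y : vectType K.

(** Identities between series are proved here as equalities of sequences, by functional
    extensionality, so that they can be rewritten inside further compositions. *)
Lemma fcomp_constl U V W (g : 'Hom(V, W)) (f : fser U V) :
  fcomp (fconst g) f = fun n => (g \o f n)%VF.
Proof.
apply: functional_extensionality => n; rewrite /fcomp big_ord_recl subn0 big1 ?addr0 //.
by move=> i _; rewrite /fconst /= comp_lfun0l.
Qed.

Lemma fcomp_constr U V W (g : fser V W) (f : 'Hom(U, V)) :
  fcomp g (fconst f) = fun n => (g n \o f)%VF.
Proof.
apply: functional_extensionality => n; rewrite /fcomp big_ord_recr /= subnn big1 ?add0r //.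
by move=> i _; rewrite /fconst subn_eq0 leqNgt ltn_ord comp_lfun0r.
Qed.

Lemma fcomp_fconst U V W (g : 'Hom(V, W)) (f : 'Hom(U, V)) :
  fcomp (fconst g) (fconst f) = fconst (g \o f)%VF.
Proof. exact/functional_extensionality/fcomp_const. Qed.

Lemma ftens_fconst U V U' V' (f : 'Hom(U, U')) (g : 'Hom(V, V')) :
  ftens (fconst f) (fconst g) = fconst (tens_map f g).
Proof. exact/functional_extensionality/ftens_const. Qed.

(** The action [fapp] is faithful and sends [fcomp] to composition of functions, which is
    associative. *)
Lemma fcompA U V W X (h : fser W X) (g : fser V W) (f : fser U V) :
  fcomp h (fcomp g f) = fcomp (fcomp h g) f.
Proof.
apply/functional_extensionality/fapp_inj => x n; rewrite !fapp_fcomp.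
by congr (fapp h _ n); apply: functional_extensionality => k; rewrite fapp_fcomp.
Qed.

Lemma fcomp1l U V (f : fser U V) : fcomp (fconst \1%VF) f = f.
Proof.
by rewrite fcomp_constl; apply: functional_extensionality => n; rewrite comp_lfun1l.
Qed.

Lemma fcomp1r U V (f : fser U V) : fcomp f (fconst \1%VF) = f.
Proof.
by rewrite fcomp_constr; apply: functional_extensionality => n; rewrite comp_lfun1r.
Qed.

Lemma fser_tens_ext U V W (f g : fser (tens U V) W) :
  (forall x y, fapp f (fpure x y) =1 fapp g (fpure x y)) -> f = g.
Proof.
move=> fg; apply: functional_extensionality => n; apply: tens_hom_ext => u v.
(* Sequences concentrated in degree 0: [fpure x y] is [pure u v] in degree 0 and vanishes elsewhere,
   so applying a series to it reads off its coefficients at [pure u v]. *)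
pose x k : U := if k == 0%N then u else 0; pose y k : V := if k == 0%N then v else 0.
have xy k : k != 0%N -> fpure x y k = 0.
  move=> k0; rewrite /fpure big1 // => i _.
  rewrite /y; case: eqP => [|_]; last by rewrite /pure linear0 mulmx0.
  move=> /eqP; rewrite subn_eq0 -ltnS /x => ki.
  rewrite ifN; first by rewrite /pure linear0 trmx0 mul0mx.
  by apply: contra k0 => /eqP i0; rewrite i0 ltnS leqn0 in ki.
have E (h : fser (tens U V) W) : fapp h (fpure x y) n = h n (pure u v).
  rewrite /fapp big_ord_recr /= subnn big1 ?add0r; last first.
    by move=> i _; rewrite xy ?linear0 // subn_eq0 -ltnNge.
  by rewrite /fpure big_ord1.
by rewrite -!E fg.
Qed.

(** Interchange law: on [fpure x y] both sides act factor by factor. *)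
Lemma ftens_comp U V W U' V' W' (g : fser V W) (f : fser U V)
    (g' : fser V' W') (f' : fser U' V') :
  ftens (fcomp g f) (fcomp g' f') = fcomp (ftens g g') (ftens f f').
Proof.
apply: fser_tens_ext => x y n; rewrite fapp_fcomp fapp_ftens.
have -> : fapp (ftens f f') (fpure x y) = fpure (fapp f x) (fapp f' y).
  by apply: functional_extensionality => k; rewrite fapp_ftens.
rewrite fapp_ftens; congr (fpure _ _ n).
  by apply: functional_extensionality => k; rewrite fapp_fcomp.
by apply: functional_extensionality => k; rewrite fapp_fcomp.
Qed.

Lemma ftens_compl U V W X (g : fser V W) (f : fser U V) :
  ftens (fcomp g f) (fconst (\1 : 'Hom(X, X))%VF) =
  fcomp (ftens g (fconst \1%VF)) (ftens f (fconst \1%VF)).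
Proof. by rewrite -ftens_comp fcomp1l. Qed.

Lemma ftens_compr U V W X (g : fser V W) (f : fser U V) :
  ftens (fconst (\1 : 'Hom(X, X))%VF) (fcomp g f) =
  fcomp (ftens (fconst \1%VF) g) (ftens (fconst \1%VF) f).
Proof. by rewrite -ftens_comp fcomp1l. Qed.

Lemma fcomp_const_monic U V W (h : 'Hom(V, W)) (f g : fser U V) :
  injective h -> fcomp (fconst h) f = fcomp (fconst h) g -> f = g.
Proof.
rewrite !fcomp_constl => hI fg; apply: functional_extensionality => n.
by apply: (hom_inj hI); apply: (congr1 (fun s : fser U W => s n) fg).
Qed.

Lemma fcomp_const_epi U V W (h : 'Hom(U, V)) (f g : fser V W) :
  (forall a b : 'Hom(V, W), (a \o h = b \o h)%VF -> a = b) ->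
  fcomp f (fconst h) = fcomp g (fconst h) -> f = g.
Proof.
rewrite !fcomp_constr => hE fg; apply: functional_extensionality => n.
by apply: hE; apply: (congr1 (fun s : fser U W => s n) fg).
Qed.

Definition ftranspose U W (f : fser U W) : fser (dual W) (dual U) :=
  fun n => transpose (f n).

Definition funtranspose U W (f : fser (dual W) (dual U)) : fser U W :=
  fun n => untranspose (f n).

Lemma funtransposeK U W : cancel (@funtranspose U W) (@ftranspose U W).
Proof. by move=> f; apply: functional_extensionality => n; apply: untransposeK. Qed.

Lemma ftranspose_inj U W : injective (@ftranspose U W).
Proof.
move=> f g fg; apply: functional_extensionality => n; apply: transpose_inj.
exact: (congr1 (fun s : fser (dual W) (dual U) => s n) fg).
Qed.

Lemma ftranspose_const U W (f : 'Hom(U, W)) :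
  ftranspose (fconst f) = fconst (transpose f).
Proof.
apply: functional_extensionality => n; rewrite /ftranspose /fconst.
by case: eqP => // _; rewrite transpose0.
Qed.

Lemma ftranspose_comp U V W (g : fser V W) (f : fser U V) :
  ftranspose (fcomp g f) = fcomp (ftranspose f) (ftranspose g).
Proof.
apply: functional_extensionality => n; rewrite /ftranspose /fcomp transpose_sum.
(* Transposition swaps the two factors, so the index [i] of the Cauchy product becomes [n - i]. *)
rewrite (reindex_inj rev_ord_inj) /=; apply: eq_bigr => i _.
by rewrite transpose_comp subSS subKn // -ltnS.
Qed.

(** Naturality of [dual_tens], one coefficient at a time. It moves [d] across tensor products in all
    the transfers of axioms below. *)
Lemma fdual_tens_nat U V U' V' (f : fser U U') (g : fser V V') :
  fcomp (fconst (dual_tens U V)) (ftens (ftranspose f) (ftranspose g)) =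
  fcomp (ftranspose (ftens f g)) (fconst (dual_tens U' V')).
Proof.
rewrite fcomp_constl fcomp_constr; apply: functional_extensionality => n.
rewrite /ftranspose /ftens transpose_sum.
rewrite (big_morph _ (comp_lfunDr _) (comp_lfun0r _ _)).
rewrite (big_morph _ (fun x y => comp_lfunDl x y _) (comp_lfun0l _ _)).
by apply: eq_bigr => i _; rewrite dual_tens_nat.
Qed.

Lemma fdual_tens_natl U V U' (f : fser U U') :
  fcomp (fconst (dual_tens U V)) (ftens (ftranspose f) (fconst \1%VF)) =
  fcomp (ftranspose (ftens f (fconst \1%VF))) (fconst (dual_tens U' V)).
Proof. by rewrite -fdual_tens_nat ftranspose_const transpose_id. Qed.

Lemma fdual_tens_natr U V V' (g : fser V V') :
  fcomp (fconst (dual_tens U V)) (ftens (fconst \1%VF) (ftranspose g)) =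
  fcomp (ftranspose (ftens (fconst \1%VF) g)) (fconst (dual_tens U V')).
Proof. by rewrite -fdual_tens_nat ftranspose_const transpose_id. Qed.

End SeriesAlgebra.

(** * Transfer of a deformation of the dual Hopf algebra to one of [H] *)

Section Predual.
Variables (K : fieldType) (V : vectType K) (H : hopfAlg V).
Variable D : deformation (dual_hopf H).

Local Notation "g \** f" := (fcomp g f) (at level 50, left associativity).
Local Notation "f \ox g" := (ftens f g) (at level 40, left associativity).
Local Notation "f ^t" := (ftranspose f) (at level 2, format "f ^t").
Local Notation c := fconst.
Local Notation d := (fconst (dual_tens _ _)).
Local Notation one := (fconst \1%VF).
Local Notation M := (fmul D).
Local Notation C := (fcomul D).

Definition premul : fser (tens V V) V := funtranspose (d \** C).
Definition precomul : fser V (tens V V) :=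
  funtranspose (M \** c (dual_tens_inv V V)).

Lemma premulT : premul^t = d \** C.
Proof. exact: funtransposeK. Qed.

Lemma precomulT : precomul^t \** d = M.
Proof.
by rewrite funtransposeK -fcompA fcomp_fconst dual_tensK fcomp1r.
Qed.

Lemma premul_0 : premul 0%N = hmul H.
Proof.
apply: transpose_inj; rewrite -[LHS]/(premul^t 0%N) premulT fcomp_constl fcomul_0.
exact: dcomul_mapK.
Qed.

Lemma precomul_0 : precomul 0%N = hcomul H.
Proof.
apply: transpose_inj; apply: dual_tens_epi.
by rewrite -[RHS]/(hmul (dual_hopf H)) -(fmul_0 D) -precomulT fcomp_constr.
Qed.

(** Transposed, both sides become [d] and [C] applied twice; coassociativity of [C] relates them,
    and [dual_assoc] matches the associators of [V] and [dual V]. *)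
Lemma premulA : premul \** (premul \ox one) =
  premul \** (one \ox premul) \** c (tens_assoc V V V).
Proof.
have CA : c (tens_assoc _ _ _) \** ((C \ox one) \** C) = (one \ox C) \** C.
  exact: (functional_extensionality _ _ (fcomulA D)).
apply: ftranspose_inj; rewrite !ftranspose_comp premulT ftranspose_const.
rewrite !fcompA -fdual_tens_natl -[in RHS](fcompA _ _ d) -fdual_tens_natr premulT.
rewrite ftens_compl ftens_compr !ftens_fconst !fcompA -[RHS]fcompA -CA.
by rewrite !fcompA !fcomp_fconst dual_assoc.
Qed.

Lemma precomulA : c (tens_assoc V V V) \** ((precomul \ox one) \** precomul) =
  (one \ox precomul) \** precomul.
Proof.
have MA : M \** (M \ox one) = M \** (one \ox M) \** c (tens_assoc _ _ _).
  exact: (functional_extensionality _ _ (fmulA D)).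
apply: ftranspose_inj; rewrite !ftranspose_comp ftranspose_const.
(* Precomposing with [d], then with [d] on the right-hand factor, then with the associator, moves
   the source from the dual of a triple tensor product to the triple tensor product of duals, the
   source of [MA]. *)
apply: (fcomp_const_epi (@dual_tens_epi _ _ _ _)).
have epi2 : forall a b : 'Hom(tens (dual V) (dual (tens V V)), dual V),
    (a \o tens_map \1 (dual_tens V V) = b \o tens_map \1 (dual_tens V V))%VF -> a = b.
  move=> a b /(congr1 (fun h => h \o tens_map \1 (dual_tens_inv V V))%VF).
  by rewrite -!comp_lfunA -!tens_map1l dual_tens_invK tens_map_id !comp_lfun1r.
apply: (fcomp_const_epi epi2).
apply: (fcomp_const_epi (@tens_assoc_epi _ _ _ _ _)).
rewrite -[RHS]fcompA -[in RHS](fcompA _ _ d) -fdual_tens_natr.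
rewrite !fcompA precomulT -(ftens_fconst \1%VF) -[in RHS](fcompA M).
rewrite -ftens_compr precomulT -MA ftens_fconst -!fcompA !fcomp_fconst.
rewrite !comp_lfunA dual_assoc -fcomp_fconst -(ftens_fconst _ \1%VF).
rewrite (fcompA _ d) -fdual_tens_natl !fcompA precomulT -fcompA.
by rewrite -ftens_compl precomulT.
Qed.

(** The bialgebra compatibility is self-dual: after transposition and precomposition with [d] it is
    the one of [D], with [dual_mid] accounting for the twist. *)
Lemma precomulM :
  (premul \ox premul) \** (c (tens_mid V V V V) \** (precomul \ox precomul)) =
  precomul \** premul.
Proof.
have CM : (M \ox M) \** (c (tens_mid _ _ _ _) \** (C \ox C)) = C \** M.
  exact: (functional_extensionality _ _ (fcomulM D)).
apply: ftranspose_inj; rewrite !ftranspose_comp ftranspose_const premulT.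
apply: (fcomp_const_epi (@dual_tens_epi _ _ _ _)).
rewrite -!fcompA precomulT -fdual_tens_nat premulT ftens_comp -CM.
rewrite !fcompA -[in RHS]precomulT ftens_comp ftens_fconst !fcompA.
rewrite fdual_tens_nat -!fcompA !(fcompA (c _)) !fcomp_fconst.
by rewrite !(fcompA (c _)) !fcomp_fconst dual_mid.
Qed.

(** The unit of [H] transposes to the counit of [dual_hopf H], so this is the left counit axiom of
    [D]. *)
Lemma premul1l : premul \** (c (hunit H) \ox one) = c (tens_lunit V).
Proof.
have Ce : c (tens_lunit _) \** ((c (dcounit_map H) \ox one) \** C) = one.
  exact: (functional_extensionality _ _ (fcounitl D)).
apply: ftranspose_inj; rewrite ftranspose_comp ftranspose_const premulT.
rewrite !fcompA -fdual_tens_natl ftranspose_const dual_lunit ftens_fconst !fcomp_fconst.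
rewrite -!comp_lfunA -tens_map_comp comp_lfun1l -dcounit_transpose.
by rewrite -!fcomp_fconst -ftens_fconst -!fcompA Ce fcomp1r.
Qed.

Lemma premul1r : premul \** (one \ox c (hunit H)) = c (tens_runit V).
Proof.
have Ce : c (tens_runit _) \** ((one \ox c (dcounit_map H)) \** C) = one.
  exact: (functional_extensionality _ _ (fcounitr D)).
apply: ftranspose_inj; rewrite ftranspose_comp ftranspose_const premulT.
rewrite !fcompA -fdual_tens_natr ftranspose_const dual_runit ftens_fconst !fcomp_fconst.
rewrite -!comp_lfunA -tens_map_comp comp_lfun1l -dcounit_transpose.
by rewrite -!fcomp_fconst -ftens_fconst -!fcompA Ce fcomp1r.
Qed.

Lemma precounitl : c (tens_lunit V) \** ((c (hcounit H) \ox one) \** precomul) = one.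
Proof.
have M1 : M \** (c (dunit_map H) \ox one) = c (tens_lunit _).
  exact: (functional_extensionality _ _ (fmul1l D)).
(* [dual_lunit] solved for the unit constraint of [dual V], by inverting [dual_scalar]. *)
have E : (transpose (tens_lunit V) \o tens_lunit (dual V) =
    dual_tens K^o V \o tens_map scalar_dual \1)%VF.
  by rewrite dual_lunit -!comp_lfunA -tens_map1r scalar_dualK tens_map_id comp_lfun1r.
apply: ftranspose_inj; rewrite !ftranspose_comp !ftranspose_const transpose_id.
apply: (fcomp_const_epi (@tens_lunit_epi _ _ _)).
rewrite fcomp1l -fcompA fcomp_fconst E -fcomp_fconst fcompA -(fcompA _ _ d).
rewrite -fdual_tens_natl !fcompA precomulT -M1 -fcompA ftranspose_const.
by rewrite !ftens_fconst fcomp_fconst -tens_map1r -dunit_transpose.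
Qed.

Lemma precounitr : c (tens_runit V) \** ((one \ox c (hcounit H)) \** precomul) = one.
Proof.
have M1 : M \** (one \ox c (dunit_map H)) = c (tens_runit _).
  exact: (functional_extensionality _ _ (fmul1r D)).
have E : (transpose (tens_runit V) \o tens_runit (dual V) =
    dual_tens V K^o \o tens_map \1 scalar_dual)%VF.
  by rewrite dual_runit -!comp_lfunA -tens_map1l scalar_dualK tens_map_id comp_lfun1r.
apply: ftranspose_inj; rewrite !ftranspose_comp !ftranspose_const transpose_id.
apply: (fcomp_const_epi (@tens_runit_epi _ _ _)).
rewrite fcomp1l -fcompA fcomp_fconst E -fcomp_fconst fcompA -(fcompA _ _ d).
rewrite -fdual_tens_natr !fcompA precomulT -M1 -fcompA ftranspose_const.
by rewrite !ftens_fconst fcomp_fconst -tens_map1l -dunit_transpose.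
Qed.

(** Comes from multiplicativity of the counit in [D]; the next lemma comes from its comultiplicative
    unit. *)
Lemma precomul1 : precomul \** c (hunit H \o tens_lunit K^o)%VF =
  c (hunit H) \ox c (hunit H).
Proof.
have eM : c (dcounit_map H) \** M =
    c (tens_lunit K^o \o tens_map (dcounit_map H) (dcounit_map H))%VF.
  exact: (functional_extensionality _ _ (fcounitM D)).
apply: ftranspose_inj; rewrite ftranspose_comp ftranspose_const.
apply: (fcomp_const_epi (@dual_tens_epi _ _ _ _)).
rewrite -fcompA precomulT -fdual_tens_nat ftranspose_const ftens_fconst fcomp_fconst.
rewrite dual_lunit_scalar -!comp_lfunA -tens_map_comp -dcounit_transpose.
rewrite -!(fcomp_fconst (transpose _)) -(fcomp_fconst scalar_dual) -eM.
rewrite transpose_comp -fcomp_fconst dcounit_transpose -!fcomp_fconst -!fcompA.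
by rewrite (fcompA (c scalar_dual)) fcomp_fconst dual_scalarK fcomp1l.
Qed.

Lemma precounitM : c (hcounit H) \** premul =
  c (tens_lunit K^o \o tens_map (hcounit H) (hcounit H))%VF.
Proof.
have C1 : C \** c (dunit_map H \o tens_lunit K^o)%VF =
    c (dunit_map H) \ox c (dunit_map H).
  exact: (functional_extensionality _ _ (fcomul1 D)).
have E : (transpose (tens_lunit K^o) \o (scalar_dual \o tens_lunit K^o) =
    dual_tens K^o K^o \o tens_map scalar_dual scalar_dual)%VF.
  rewrite dual_lunit_scalar -!comp_lfunA -tens_map_comp scalar_dualK tens_map_id.
  by rewrite comp_lfun1r.
(* The source [dual K^o] must be replaced by the tensor square of [K^o], where [C1] is stated. *)
have epi (a b : 'Hom(dual K^o, dual (tens V V))) :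
    (a \o (scalar_dual \o tens_lunit K^o) = b \o (scalar_dual \o tens_lunit K^o))%VF ->
    a = b.
  rewrite !comp_lfunA => /tens_lunit_epi /(congr1 (fun h => h \o dual_scalar)%VF).
  by rewrite -!comp_lfunA dual_scalarK !comp_lfun1r.
apply: ftranspose_inj; rewrite ftranspose_comp !ftranspose_const premulT.
apply: (fcomp_const_epi epi).
rewrite fcomp_fconst transpose_comp -[in RHS]comp_lfunA E comp_lfunA -dual_tens_nat.
rewrite -comp_lfunA -tens_map_comp -dunit_transpose -!fcompA !fcomp_fconst.
by rewrite comp_lfunA -dunit_transpose C1 ftens_fconst fcomp_fconst.
Qed.

Lemma preantipodel :
  premul \** ((c (hantipode H) \ox one) \** precomul) = c (hunit H \o hcounit H)%VF.
Proof.
have MS : M \** ((c (transpose (hantipode H)) \ox one) \** C) =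
    c (dunit_map H \o dcounit_map H)%VF.
  exact: (functional_extensionality _ _ (fantipodel D)).
apply: ftranspose_inj; rewrite !ftranspose_comp ftranspose_const premulT.
rewrite fcompA -(fcompA _ _ d) -fdual_tens_natl !fcompA precomulT.
by rewrite ftranspose_const -fcompA MS dual_unit_counit.
Qed.

Lemma preantipoder :
  premul \** ((one \ox c (hantipode H)) \** precomul) = c (hunit H \o hcounit H)%VF.
Proof.
have MS : M \** ((one \ox c (transpose (hantipode H))) \** C) =
    c (dunit_map H \o dcounit_map H)%VF.
  exact: (functional_extensionality _ _ (fantipoder D)).
apply: ftranspose_inj; rewrite !ftranspose_comp ftranspose_const premulT.
rewrite fcompA -(fcompA _ _ d) -fdual_tens_natr !fcompA precomulT.
by rewrite ftranspose_const -fcompA MS dual_unit_counit.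
Qed.

Definition predual_deformation : deformation H := {|
  fmul := premul;
  fcomul := precomul;
  fmul_0 := premul_0;
  fcomul_0 := precomul_0;
  fmulA n := congr1 (@^~ n) premulA;
  fcomulA n := congr1 (@^~ n) precomulA;
  fcomulM n := congr1 (@^~ n) precomulM;
  fmul1l n := congr1 (@^~ n) premul1l;
  fmul1r n := congr1 (@^~ n) premul1r;
  fcounitl n := congr1 (@^~ n) precounitl;
  fcounitr n := congr1 (@^~ n) precounitr;
  fcomul1 n := congr1 (@^~ n) precomul1;
  fcounitM n := congr1 (@^~ n) precounitM;
  fantipodel n := congr1 (@^~ n) preantipodel;
  fantipoder n := congr1 (@^~ n) preantipoder
|}.

Lemma predual_trivial :
  trivial_deformation predual_deformation -> trivial_deformation D.
Proof.
case=> phi [psi [phi0 [pq qp] Em Ec]].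
have {}pq : phi \** psi = one by apply: functional_extensionality.
have {}qp : psi \** phi = one by apply: functional_extensionality.
have {}Em : c (hmul H) = psi \** (premul \** (phi \ox phi)).
  exact: functional_extensionality.
have {}Ec : c (hcomul H) = (psi \ox psi) \** (precomul \** phi).
  exact: functional_extensionality.
(* Transposition reverses composition, so the series and its inverse exchange roles. *)
exists psi^t, phi^t; split.
(* In degree 0, [pq] and [phi0] force [psi 0] to be the identity. *)
- have := congr1 (@^~ 0%N) pq.
  rewrite /fcomp big_ord1 phi0 comp_lfun1l /ftranspose /= => ->.
  exact: transpose_id.
- by split=> n; rewrite -ftranspose_comp (pq, qp) ftranspose_const transpose_id.
(* The equation for the product is the transpose of [Ec], precomposed with [d]. *)
- move=> n; congr (_ n); rewrite -precomulT -[LHS]/(c (dmul_map H)).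
  rewrite -fcompA fdual_tens_nat !fcompA -!ftranspose_comp -Ec.
  by rewrite ftranspose_const fcomp_fconst.
- move=> n; congr (_ n); rewrite -[LHS]/(c (dcomul_map H)).
  (* As [d] is injective, the coproduct equation may be checked after composing with it, where it is
     the transpose of [Em]. *)
  apply: (fcomp_const_monic (@dual_tens_inj _ _ _)).
  rewrite fcomp_fconst dcomul_mapK -ftranspose_const Em !ftranspose_comp.
  by rewrite premulT !fcompA -fdual_tens_nat.
Qed.

End Predual.

Theorem theorem4p1 (K : closedFieldType) (K_char0 : [pchar K] =i pred0)
    (V : vectType K) (H : hopfAlg V) :
  rigid H -> rigid (dual_hopf H).
Proof. by move=> rH D; apply/predual_trivial/rH. Qed.
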